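(* Let $a,b \in \mathbb{C}$ with $4a^3+27b^2 \neq 0$, let $E$ be the elliptic curve $v^2 = u^3 + au + b$, and let $B = E^{\vee}$ be its dual curve (a sextic with $9$ cusps), given by $F_B(T,X,Z) = 0$ with $F_B$ the homogeneous sextic polynomial defined in the context. Then $$ Z^6 F_B(T,X,Z) = \left\{\sqrt[3]{-4}\left(-\tfrac13 X^4 - 2TXZ^2 + aZ^4\right)\right\}^3 + \left\{\sqrt{-27}\left(-\tfrac{2}{27}X^6 - \tfrac13\left(2TXZ^2 - aZ^4\right)X^2 - T^2Z^4 + bZ^6\right)\right\}^2, $$ where $\sqrt[3]{-4}$ and $\sqrt{-27}$ denote complex numbers with cube $-4$ and square $-27$, respectively. This is a $(2,3,6)$ quasi-torus decomposition of $B$.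
   Context: For $(t,x) \in \mathbb{C}^2$ let $l_{t,x}$ be the line $v = xu + t$. Eliminating $v$ between $E$ and $l_{t,x}$ gives the cubic in $u$ $$p(u) = u^3 - x^2u^2 - (2tx - a)u - t^2 + b.$$ Let $D_E(t,x)$ be the discriminant of $p(u)$ with respect to $u$; explicitly $$D_E(t,x) = -4atx^5 + 4bx^6 + a^2x^4 - 4t^3x^3 - 30at^2x^2 + 36btx^3 + 24a^2tx - 18abx^2 - 27t^4 - 4a^3 + 54bt^2 - 27b^2.$$ Put $F_B(T,X,Z) = Z^6 D_E(T/Z, X/Z)$, a homogeneous polynomial of degree $6$. The dual curve $B = E^{\vee}$ (the curve of tangent lines to $E$, in the coordinates $[T,X,Z]$ with $t = T/Z$, $x = X/Z$) is given by $F_B = 0$. A plane curve given by a homogeneous equation $F(T,X,Z)=0$ is a quasi-torus curve of type $(p,q,r)$ if $F_3^r F = F_1^p + F_2^q$ for some pairwise coprime homogeneous polynomials $F_1, F_2, F_3$; such an identity is called a $(p,q,r)$ quasi-torus decomposition. (In the claim, $p=2$, $q=3$, $r=6$ and $F_3 = Z$.) *)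

(* Defs.v *)
From HB Require Import structures.
From mathcomp Require Import all_boot all_order all_algebra.
From mathcomp Require Import mpoly complex reals.

Set Implicit Arguments.
Unset Strict Implicit.
Unset Printing Implicit Defensive.

Import GRing.Theory Num.Theory.

Local Open Scope ring_scope.

Definition point3 (K : Type) (x y z : K) : 'I_3 -> K := tnth [tuple x; y; z].

Section PlaneCurves.
Variable K : fieldType.
Implicit Types (F G : {mpoly K[3]}) (P L : 'I_3 -> K) (d : nat).

(* Projective points and lines are given by homogeneous coordinate triples. *)
Definition nonzero_coords P : Prop := exists i, P i != 0.

(* L stands for the line L 0 * U + L 1 * V + L 2 * W = 0; it is tangent to the
   curve G = 0 at P when it is proportional to the gradient of G at P.  Since L
   is nonzero, P is then a nonsingular point. *)
Definition tangent_line G L : Prop :=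
  nonzero_coords L /\
  exists P, [/\ nonzero_coords P, G.@[P] = 0
    & exists2 c, c != 0 & forall i, L i = c * (G^`M(i)).@[P]].

Definition homogeneous F : Prop := exists d, F \is d.-homog.

(* B, seen as a set of coordinate triples, is the plane curve F = 0. *)
Definition plane_curve_given_by (B : ('I_3 -> K) -> Prop) F d : Prop :=
  [/\ F != 0, F \is d.-homog
    & forall P, nonzero_coords P -> (B P <-> F.@[P] = 0)].

(* The units of a polynomial ring over a field are the nonzero constants. *)
Definition coprime_mpoly F G : Prop :=
  forall D F' G', F = D * F' -> G = D * G' -> D \is a GRing.unit.

Definition quasi_torus_decomposition (p q r : nat) F F1 F2 F3 : Prop :=
  [/\ homogeneous F1, homogeneous F2 & homogeneous F3] /\
  [/\ coprime_mpoly F1 F2, coprime_mpoly F1 F3 & coprime_mpoly F2 F3] /\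
  F3 ^+ r * F = F1 ^+ p + F2 ^+ q.

(* The form Z^d f(T/Z, X/Z) in the variables T = 'X_0, X = 'X_1, Z = 'X_2,
   for f of degree at most d. *)
Definition homogenize d (f : {mpoly K[2]}) : {mpoly K[3]} :=
  \sum_(m : 'X_{1..2 < d.+1})
    f@_m *: ('X_0 ^+ m 0 * 'X_1 ^+ m 1 * 'X_2 ^+ (d - mdeg m)).

End PlaneCurves.

(* For a monic p of degree n, disc(p) = (-1)^(n(n-1)/2) Res(p, p'). *)
Definition monic_discriminant (A : comNzRingType) (p : {poly A}) : A :=
  (-1) ^+ 'C((size p).-1, 2) * resultant p p^`().

Section EllipticCurve.
Variable K : fieldType.
Variables a b : K.

(* The projective closure of v^2 = u^3 + a u + b, with coordinates
   U = 'X_0, V = 'X_1, W = 'X_2, u = U / W, v = V / W. *)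
Definition E_poly : {mpoly K[3]} :=
  'X_1 ^+ 2 * 'X_2 - ('X_0 ^+ 3 + a *: ('X_0 * 'X_2 ^+ 2) + b *: 'X_2 ^+ 3).

(* [T, X, Z] stands for the line v = (X / Z) u + T / Z, that is
   X U - Z V + T W = 0. *)
Definition dual_E (P : 'I_3 -> K) : Prop :=
  tangent_line E_poly (point3 (P 1) (- P 2) (P 0)).

(* The cubic in u with coefficients in K[t, x], where t = 'X_0, x = 'X_1. *)
Definition p_E : {poly {mpoly K[2]}} :=
  let t : {mpoly K[2]} := 'X_0 in let x : {mpoly K[2]} := 'X_1 in
  'X^3 - (x ^+ 2)%:P * 'X^2 - (2 * t * x - a%:MP)%:P * 'X
  + (- t ^+ 2 + b%:MP)%:P.

Definition D_E : {mpoly K[2]} := monic_discriminant p_E.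

Definition F_B : {mpoly K[3]} := homogenize 6 D_E.

End EllipticCurve.

(* Main.v *)
Require Import Defs.
From HB Require Import structures.
From mathcomp Require Import all_boot all_order all_algebra.
From mathcomp Require Import mpoly complex reals.
From mathcomp Require Import ring zify.

Set Implicit Arguments.
Unset Strict Implicit.

Import GRing.Theory Num.Theory.
Local Open Scope ring_scope.

(** A tangent line v = xu + t of E corresponds to a double root of p(u), so B is
    given by the discriminant; the vertical tangents and the flex tangent at
    infinity are the points of B on Z = 0.  Translating u by x^2/3 brings p(u) to
    the depressed form y^3 + P y + Q, whose discriminant -4 P^3 - 27 Q^2 is the
    torus decomposition.  Coprimality is tested on a single line T = t Z: both
    forms have a constant leading coefficient in X, so a nonconstant common factor
    would have a zero on every such line. *)

(** * Discriminant of a monic cubic, through its Sylvester determinant *)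

Definition seqmx (A : nzRingType) n (s : seq (seq A)) : 'M[A]_n :=
  \matrix_(i, j) nth 0 (nth [::] s i) j.

Lemma det_seqmx0 (A : comNzRingType) (s : seq (seq A)) : \det (seqmx 0 s) = 1.
Proof. exact: det_mx00. Qed.

(** Laplace expansion along the first column. With rows stored as lists, deleting a row is
    [take]/[drop] and deleting the column is [behead], so a concrete determinant unfolds by
    computation. *)
Lemma det_seqmxS (A : comNzRingType) n (s : seq (seq A)) :
  \det (seqmx n.+1 s) = \sum_(i < n.+1) (-1) ^+ i * (nth [::] s i)`_0 *
     \det (seqmx n (map behead (take i s ++ drop i.+1 s))).
Proof.
rewrite (expand_det_col _ ord0); apply: eq_bigr => i _.
rewrite mxE /cofactor addn0 mulrCA mulrA; congr (_ * \det _).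
apply/matrixP => k l; rewrite !mxE /= -nth_behead; congr (nth _ _ _).
(* Rows past the end of the list read as empty, hence as zero rows, so an index out of range is
   treated apart. *)
have [lt_k|le_k] := ltnP k (size (take i s ++ drop i.+1 s)); last first.
  rewrite [RHS]nth_default ?size_map // nth_default //.
  move: le_k; rewrite size_cat size_take size_drop /bump.
  by case: ltnP => ?; case: leqP => /= ?; lia.
rewrite (nth_map [::]) //; congr behead.
rewrite nth_cat size_take /bump; case: (ltnP i (size s)) => lt_i.
  case: ltnP => ki; first by rewrite nth_take // leqNgt ki.
  by rewrite nth_drop; congr nth; lia.
rewrite take_oversize // drop_oversize ?cats0 in lt_k *; last exact: leqW.
by rewrite lt_k leqNgt (leq_trans lt_k).
Qed.

Lemma resultant_cubic_quadratic (A : comNzRingType) (p q : {poly A}) :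
  size p = 4 -> size q = 3 ->
  resultant p q = \det (seqmx 5
      [:: [:: p`_0; p`_1; p`_2; p`_3; 0];
          [:: 0; p`_0; p`_1; p`_2; p`_3];
          [:: q`_0; q`_1; q`_2; 0; 0];
          [:: 0; q`_0; q`_1; q`_2; 0];
          [:: 0; 0; q`_0; q`_1; q`_2]]).
Proof.
move=> sp sq.
have p4 : p`_4 = 0 by rewrite nth_default ?sp.
have q3 : q`_3 = 0 by rewrite nth_default ?sq.
have q4 : q`_4 = 0 by rewrite nth_default ?sq.
rewrite /resultant.
(* The dimension of the Sylvester matrix depends on [size p] and [size q]. Generalizing the matrix,
   with only its entries remembered, allows these sizes to be rewritten to numerals. *)
have : forall i j, Sylvester_mx p q i j =
    match split i with
    | inl k => p`_(j - k) *+ (k <= j)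
    | inr k => q`_(j - k) *+ (k <= j)
    end by move=> i j; rewrite Sylvester_mxE.
move: (Sylvester_mx p q); rewrite sp sq /= => M HM.
congr (\det _); apply/matrixP => i j; rewrite HM mxE.
case: splitP => [] k ->; case: k => [[|[|[|k]]] // ?]; case: j => [[|[|[|[|[|j]]]]] ?] //=.
Qed.

Lemma cubic_discriminant (A : comNzRingType) (a2 a1 a0 : A) : (3%:R : A) != 0 ->
  monic_discriminant ('X^3 + a2%:P * 'X^2 + a1%:P * 'X + a0%:P) =
  a2^+2 * a1 ^+ 2 - 4 * a1 ^+ 3 - 4 * a2 ^+ 3 * a0 - 27 * a0 ^+ 2
  + 18 * a2 * a1 * a0.
Proof.
move=> nz3; set p := (X in monic_discriminant X).
have pE : p = Poly [:: a0; a1; a2; 1].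
  by rewrite /p /= !cons_poly_def; ring.
have sp : size p = 4 by rewrite pE (@PolyK _ 0) //= oner_neq0.
have cp i : p`_i = [:: a0; a1; a2; 1]`_i by rewrite pE coef_Poly.
(* The leading coefficient of the derivative is 3, so the size is exact because 3 is nonzero in
   [A]. *)
have sq : size p^`() = 3.
  apply/eqP; rewrite eqn_leq; apply/andP; split.
    by apply/leq_sizeP => -[|[|[|i]]] // _; rewrite coef_deriv cp /= nth_nil mul0rn.
  by rewrite ltnNge; apply/negP => /leq_sizeP/(_ 2 isT)/eqP; rewrite coef_deriv cp; apply/negP.
rewrite /monic_discriminant resultant_cubic_quadratic // sp.
rewrite !coef_deriv !cp /=.
do 4![rewrite ?det_seqmxS; rewrite !big_ord_recl !big_ord0 /=
  ?(mulr0, mul0r, addr0, add0r)].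
rewrite ?det_seqmxS !big_ord_recl !big_ord0 /= !det_seqmx0 /bump /=.
ring.
Qed.

(** * Homogenization, monomial by monomial *)

Section Homogenize.
Variable K : fieldType.
Implicit Types (f g : {mpoly K[2]}) (d : nat).

Lemma homogenizeD d f g : homogenize d (f + g) = homogenize d f + homogenize d g.
Proof.
by rewrite /homogenize -big_split; apply: eq_bigr => m _; rewrite mcoeffD scalerDl.
Qed.

Lemma homogenize_monomial d (c : K) i j : (i + j <= d)%N ->
  homogenize d (c *: ('X_0 ^+ i * 'X_1 ^+ j) : {mpoly K[2]}) =
  c *: ('X_0 ^+ i * 'X_1 ^+ j * 'X_2 ^+ (d - (i + j))).
Proof.
move=> le_d; pose m0 : 'X_{1..2} := (U_(0%R) *+ i + U_(1%R) *+ j)%MM.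
have m00 : m0 0 = i by rewrite mnmDE !mulmnE !mnm1E eqxx /= ; lia.
have m01 : m0 1 = j by rewrite mnmDE !mulmnE !mnm1E eqxx /= ; lia.
have dm0 : mdeg m0 = (i + j)%N by rewrite mdegD !mdegMn !mdeg1 !mul1n.
have lt_m0 : (mdeg m0 < d.+1)%N by rewrite dm0.
have -> : 'X_0 ^+ i * 'X_1 ^+ j = 'X_[m0] :> {mpoly K[2]} by rewrite !mpolyXn -mpolyXD.
rewrite /homogenize.
rewrite (bigD1 (BMultinom lt_m0)) //= big1 ?addr0 => [|m ne_m].
  by rewrite mcoeffZ mcoeffX eqxx mulr1 m00 m01 dm0.
rewrite mcoeffZ mcoeffX (_ : (m0 == m) = false) ?mulr0 ?scale0r //.
by apply/negbTE; apply: contra ne_m => /eqP m0E; apply/eqP/val_inj.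
Qed.

Lemma dhomog_homogenize d f : homogenize d f \is d.-homog.
Proof.
apply: rpred_sum => m _; apply: rpredZ.
have dE : (m 0%R + m 1%R + (d - mdeg m))%N = d.
  have := bmdeg m; rewrite mdegE !big_ord_recl big_ord0 addn0 /=.
  rewrite (_ : lift _ _ = 1%R) => [? |]; last exact: val_inj.
  by rewrite subnKC.
rewrite !mpolyXn; apply: (eq_ind _ (fun e => _ \is e.-homog) _ _ dE).
by apply: dhomogM; first apply: dhomogM; rewrite dhomogX /= mdegMn mdeg1 mul1n ?dE.
Qed.

End Homogenize.

(** * The forms over an arbitrary commutative ring, for use both on polynomials and on their
    values *)

Section Forms.
Variable A : comNzRingType.
Implicit Types (r a b T X Z U V W : A).

Definition weierstrass_form a b U V W : A :=
  V ^+ 2 * W - (U ^+ 3 + a * U * W ^+ 2 + b * W ^+ 3).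

(** This is [Z^6 D_E(T/Z, X/Z)]. It is even in [Z] and written in powers of [Z ^+ 2], since the
    coordinates of a tangent line provide [-Z]. *)
Definition dual_sextic_form a b T X Z : A :=
  - 4 * a * T * X ^+ 5 + 4 * b * X ^+ 6 + a ^+ 2 * X ^+ 4 * Z ^+ 2
  - 4 * T ^+ 3 * X ^+ 3 - 30 * a * T ^+ 2 * X ^+ 2 * Z ^+ 2
  + 36 * b * T * X ^+ 3 * Z ^+ 2 + 24 * a ^+ 2 * T * X * (Z ^+ 2) ^+ 2
  - 18 * a * b * X ^+ 2 * (Z ^+ 2) ^+ 2 - 27 * T ^+ 4 * Z ^+ 2
  + 54 * b * T ^+ 2 * (Z ^+ 2) ^+ 2
  - (4 * a ^+ 3 + 27 * b ^+ 2) * (Z ^+ 2) ^+ 3.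

(* The coefficients of the depressed cubic obtained by translating the variable
   of the cubic in u by x^2/3; the parameter r stands for 1/3. *)
Definition depressed_linear_form r a T X Z : A :=
  - r * X ^+ 4 - 2 * (T * X * Z ^+ 2) + a * Z ^+ 4.

Definition depressed_constant_form r a b T X Z : A :=
  - 2 * r ^+ 3 * X ^+ 6 - r * ((2 * (T * X * Z ^+ 2) - a * Z ^+ 4) * X ^+ 2)
  - T ^+ 2 * Z ^+ 4 + b * Z ^+ 6.

Lemma depressed_cubic_identity r a b T X Z : 3 * r = 1 ->
  Z ^+ 6 * dual_sextic_form a b T X Z =
  -4 * depressed_linear_form r a T X Z ^+ 3
  + -27 * depressed_constant_form r a b T X Z ^+ 2.
Proof.
(* [ring] cannot use [3 * r = 1]; putting [X = 3 * Y] clears every [r] and leaves an identity with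
   integer coefficients. *)
move=> h3; have [Y XE YE] : exists2 Y, X = 3 * Y & r * X = Y.
  by exists (r * X); rewrite // mulrA h3 mul1r.
have e1 : - r * X ^+ 4 = - 27 * Y ^+ 4.
  by rewrite (_ : _ * _ = - (r * X) * X ^+ 3); [rewrite YE XE|]; ring.
have e2 : - 2 * r ^+ 3 * X ^+ 6 = - 54 * Y ^+ 6.
  by rewrite (_ : _ * _ = - 2 * (r * X) ^+ 3 * X ^+ 3); [rewrite YE XE|]; ring.
have e3 c : r * (c * X ^+ 2) = 3 * c * Y ^+ 2.
  by rewrite (_ : r * _ = c * (r * X) * X); [rewrite YE XE|]; ring.
rewrite /depressed_linear_form /depressed_constant_form e1 e2 e3 XE.
by rewrite /dual_sextic_form; ring.
Qed.

End Forms.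

Section FormsMorphism.
Variables (A B : comNzRingType) (f : {rmorphism A -> B}).

Lemma rmorph_weierstrass_form a b U V W :
  f (weierstrass_form a b U V W) = weierstrass_form (f a) (f b) (f U) (f V) (f W).
Proof. by rewrite /weierstrass_form; ring. Qed.

Lemma rmorph_dual_sextic_form a b T X Z :
  f (dual_sextic_form a b T X Z) = dual_sextic_form (f a) (f b) (f T) (f X) (f Z).
Proof. by rewrite /dual_sextic_form; ring. Qed.

Lemma rmorph_depressed_linear_form r a T X Z :
  f (depressed_linear_form r a T X Z) =
  depressed_linear_form (f r) (f a) (f T) (f X) (f Z).
Proof. by rewrite /depressed_linear_form; ring. Qed.

Lemma rmorph_depressed_constant_form r a b T X Z :
  f (depressed_constant_form r a b T X Z) =
  depressed_constant_form (f r) (f a) (f b) (f T) (f X) (f Z).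
Proof. by rewrite /depressed_constant_form; ring. Qed.

End FormsMorphism.

(** * Explicit equations of the dual sextic and of the cubic *)

Section DualSextic.
Variable K : numClosedFieldType.
Variables a b : K.

(** Exponents 0 and 1 are kept visible so that each term has the shape expected by
    [homogenize_monomial]. *)
Lemma D_E_explicit : D_E a b =
  (-4 * a) *: ('X_0 ^+ 1 * 'X_1 ^+ 5) + (4 * b) *: ('X_0 ^+ 0 * 'X_1 ^+ 6)
  + a ^+ 2 *: ('X_0 ^+ 0 * 'X_1 ^+ 4) + (-4) *: ('X_0 ^+ 3 * 'X_1 ^+ 3)
  + (-30 * a) *: ('X_0 ^+ 2 * 'X_1 ^+ 2) + (36 * b) *: ('X_0 ^+ 1 * 'X_1 ^+ 3)
  + (24 * a ^+ 2) *: ('X_0 ^+ 1 * 'X_1 ^+ 1)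
  + (-18 * a * b) *: ('X_0 ^+ 0 * 'X_1 ^+ 2)
  + (-27) *: ('X_0 ^+ 4 * 'X_1 ^+ 0) + (54 * b) *: ('X_0 ^+ 2 * 'X_1 ^+ 0)
  + (-4 * a ^+ 3 - 27 * b ^+ 2) *: ('X_0 ^+ 0 * 'X_1 ^+ 0).
Proof.
rewrite /D_E.
have -> : p_E a b = 'X^3 + (- 'X_1 ^+ 2)%:P * 'X^2
    + (a%:MP - 2 * 'X_0 * 'X_1)%:P * 'X + (- 'X_0 ^+ 2 + b%:MP)%:P.
  by rewrite /p_E; ring.
rewrite cubic_discriminant; last by rewrite -mpolyC_nat mpolyC_eq0 pnatr_eq0.
by rewrite -!mul_mpolyC; ring.
Qed.

Lemma F_B_explicit : F_B a b = dual_sextic_form a%:MP b%:MP 'X_0 'X_1 'X_2.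
Proof.
rewrite /F_B D_E_explicit !homogenizeD !homogenize_monomial //.
rewrite !addn0 !add0n !subnn /= -!mul_mpolyC /dual_sextic_form.
by ring.
Qed.

Lemma meval_F_B (P : 'I_3 -> K) :
  (F_B a b).@[P] = dual_sextic_form a b (P 0) (P 1) (P 2).
Proof. by rewrite F_B_explicit rmorph_dual_sextic_form /= !mevalC !mevalXU. Qed.

Lemma E_polyE : E_poly a b = weierstrass_form a%:MP b%:MP 'X_0 'X_1 'X_2.
Proof. by rewrite /E_poly -!mul_mpolyC /weierstrass_form; ring. Qed.

Lemma meval_E_poly (Q : 'I_3 -> K) :
  (E_poly a b).@[Q] = weierstrass_form a b (Q 0) (Q 1) (Q 2).
Proof. by rewrite E_polyE rmorph_weierstrass_form /= !mevalC !mevalXU. Qed.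

End DualSextic.

Lemma point3E (K : Type) (x y z : K) :
  (point3 x y z 0 = x) * (point3 x y z 1 = y) * (point3 x y z 2 = z).
Proof. by []. Qed.

Lemma ord3P (Q : 'I_3 -> Prop) : Q 0 -> Q 1 -> Q 2 -> forall i, Q i.
Proof.
move=> Q0 Q1 Q2 [[|[|[|i]]] // lt_i].
- by rewrite (_ : Ordinal lt_i = 0); last exact: val_inj.
- by rewrite (_ : Ordinal lt_i = 1); last exact: val_inj.
- by rewrite (_ : Ordinal lt_i = 2); last exact: val_inj.
Qed.

(** * Coprimality of forms, tested on one line *)

Section CoprimeCriterion.
Variable K : closedFieldType.

(* Reads a form in T, X, Z as a polynomial in X over K[T, X, Z]. *)
Definition poly_in_X : {mpoly K[3]} -> {poly {mpoly K[3]}} :=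
  mmap (polyC \o @mpolyC 3 K) (point3 ('X_0)%:P 'X ('X_2)%:P).

HB.instance Definition _ := GRing.RMorphism.copy poly_in_X
  (mmap (polyC \o @mpolyC 3 K) (point3 ('X_0)%:P 'X ('X_2)%:P)).

Lemma poly_in_XC c : poly_in_X c%:MP = c%:MP%:P.
Proof. exact: mmapC. Qed.

Lemma poly_in_XU i : poly_in_X 'X_i = point3 ('X_0)%:P 'X ('X_2)%:P i.
Proof. by rewrite /poly_in_X mmapX mmap1U. Qed.

Lemma horner_poly_in_X F : (poly_in_X F).['X_1] = F.
Proof.
rewrite /poly_in_X /mmap horner_sum [RHS]mpolyE.
apply: eq_bigr => m _ /=.
rewrite hornerCM -mul_mpolyC; congr (_ * _).
rewrite (mpolyXE_id _ m) /mmap1 horner_prod; apply: eq_bigr => i _.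
by rewrite horner_exp; congr (_ ^+ _); move: i; apply: ord3P; rewrite !point3E ?hornerC ?hornerX.
Qed.

Lemma horner_map_poly_in_X F (P : 'I_3 -> K) x :
  (map_poly (meval P) (poly_in_X F)).[x] = F.@[point3 (P 0) x (P 2)].
Proof.
rewrite /poly_in_X /mmap mevalE rmorph_sum horner_sum; apply: eq_bigr => m _ /=.
rewrite rmorphM /= map_polyC /= mevalC hornerCM; congr (_ * _).
rewrite /mmap1 rmorph_prod horner_prod; apply: eq_bigr => i _.
rewrite rmorphXn horner_exp; congr (_ ^+ _).
move: i; apply: ord3P; rewrite !point3E /=.
- by rewrite map_polyC /= hornerC mevalXU.
- by rewrite map_polyX hornerX.
- by rewrite map_polyC /= hornerC mevalXU.
Qed.

(* A common divisor of F and G has, up to a unit, leading coefficient 1 in X, so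
   if it is not constant it has a root on every line T = t, Z = z. *)
Lemma coprime_mpoly_of_line F G (P : 'I_3 -> K) :
    lead_coef (poly_in_X F) \is a GRing.unit ->
    (forall x, F.@[point3 (P 0) x (P 2)] = 0 ->
               G.@[point3 (P 0) x (P 2)] <> 0) ->
  coprime_mpoly F G.
Proof.
move=> unitF no_root D F' G' FE GE.
have unitD : lead_coef (poly_in_X D) \is a GRing.unit.
  move: unitF; rewrite FE rmorphM /= lead_coefM unitrM => /andP[unitD _].
  exact: unitD.
(* A unit leading coefficient survives evaluation at [P], so restriction to the line preserves the
   degree in [X]. *)
have size_map : size (map_poly (meval P) (poly_in_X D)) = size (poly_in_X D).
  rewrite size_map_poly_id0 //= -unitfE; apply: (rmorph_unit (meval P)).
  exact: unitD.
have [|size_le1] := ltnP 1 (size (poly_in_X D)).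
  rewrite -size_map => /ltn_eqF/negbT; rewrite eq_sym => /closed_rootP[x].
  rewrite /root horner_map_poly_in_X => /eqP Dx; case: (no_root x).
    by rewrite FE mevalM Dx mul0r.
  by rewrite GE mevalM Dx mul0r.
(* If [D] has degree 0 in [X], it coincides with its leading coefficient, which is a unit. *)
have := size1_polyC size_le1; move: (_`_0) => c DE.
by move: (horner_poly_in_X D) unitD; rewrite DE hornerC lead_coefC => ->.
Qed.

Lemma lead_coef_poly_in_X_unit F (c : K) n (q : {poly {mpoly K[3]}}) :
    c != 0 -> (size q <= n)%N -> poly_in_X F = c%:MP%:P * 'X^n + q ->
  lead_coef (poly_in_X F) \is a GRing.unit.
Proof.
move=> c0 le_q ->; have c0' : c%:MP != 0 :> {mpoly K[3]} by rewrite mpolyC_eq0.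
rewrite lead_coefDl ?mul_polyC ?size_scale ?size_polyXn //.
rewrite lead_coefZ lead_coefXn mulr1.
by apply: (rmorph_unit (@mpolyC 3 K)); rewrite unitfE.
Qed.

End CoprimeCriterion.

(** * Gradient of the Weierstrass cubic *)

Section Derivation.
Variables (A : comNzRingType) (d : {additive A -> A}).
Hypothesis dM : forall x y, d (x * y) = d x * y + x * d y.

(** Stated for any derivation killing [a] and [b], so that one application of the Leibniz rule
    serves all three partial derivatives. *)
Lemma derivation_weierstrass_form a b U V W : d a = 0 -> d b = 0 ->
  d (weierstrass_form a b U V W) =
  (- 3 * U ^+ 2 - a * W ^+ 2) * d U + 2 * V * W * d V
  + (V ^+ 2 - 2 * a * U * W - 3 * b * W ^+ 2) * d W.
Proof.
move=> da db; rewrite /weierstrass_form !exprS !expr0 !mulr1.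
by rewrite raddfB !raddfD /= !dM da db; ring.
Qed.

End Derivation.

Lemma mderivXU n (R : comNzRingType) (i j : 'I_n) :
  ('X_j : {mpoly R[n]})^`M(i) = (j == i)%:R.
Proof.
rewrite mderivX mnm1E; case: eqP => [->|_]; last by rewrite scale0r.
by rewrite scale1r -[X in (X - _)%MM]add0m addmK mpolyX0.
Qed.

(** * The dual curve as the zero locus of the sextic *)

Section DualCurve.
Variable K : numClosedFieldType.
Variables a b : K.
Hypothesis smooth : 4 * a ^+ 3 + 27 * b ^+ 2 != 0.

Lemma E_gradient (Q : 'I_3 -> K) :
  [/\ ((E_poly a b)^`M(0)).@[Q] = - 3 * Q 0 ^+ 2 - a * Q 2 ^+ 2,
      ((E_poly a b)^`M(1)).@[Q] = 2 * Q 1 * Q 2 &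
      ((E_poly a b)^`M(2)).@[Q] =
        Q 1 ^+ 2 - 2 * a * Q 0 * Q 2 - 3 * b * Q 2 ^+ 2].
Proof.
have dE (i : 'I_3) := derivation_weierstrass_form (mderivM i)
  'X_0 'X_1 'X_2 (mderivC i a) (mderivC i b).
rewrite E_polyE; split; rewrite dE /= !mderivXU /= !(mulr1, mulr0, addr0, add0r).
all: rewrite -?[Q 0](mevalXU Q) -?[Q 1](mevalXU Q) -?[Q 2](mevalXU Q).
- by rewrite -[a in RHS](mevalC Q); ring.
- by ring.
- by rewrite -[a in RHS](mevalC Q) -[b in RHS](mevalC Q); ring.
Qed.

Lemma dual_EP (P : 'I_3 -> K) : nonzero_coords P ->
  dual_E a b P <-> exists Q c, [/\ nonzero_coords Q, (E_poly a b).@[Q] = 0, c != 0 &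
   [/\ P 1 = c * (- 3 * Q 0 ^+ 2 - a * Q 2 ^+ 2),
    - P 2 = c * (2 * Q 1 * Q 2) &
    P 0 = c * (Q 1 ^+ 2 - 2 * a * Q 0 * Q 2 - 3 * b * Q 2 ^+ 2)]].
Proof.
move=> P0; split=> [[_ [Q [Q0 EQ [c c0 LE]]]]|[Q [c [Q0 EQ c0 [L0 L1 L2]]]]].
  have [g0 g1 g2] := E_gradient Q.
  exists Q, c; split=> //; split.
  - by rewrite -g0 -LE.
  - by rewrite -g1 -LE.
  - by rewrite -g2 -LE.
split.
  case: P0; apply: ord3P => Pi.
  - by exists 2; rewrite point3E.
  - by exists 0; rewrite point3E.
  - by exists 1; rewrite point3E oppr_eq0.
have [g0 g1 g2] := E_gradient Q.
exists Q; split=> //; exists c => //; apply: ord3P; rewrite point3E.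
- by rewrite g0.
- by rewrite g1.
- by rewrite g2.
Qed.

Lemma dual_E_sub_F_B P : nonzero_coords P -> dual_E a b P -> (F_B a b).@[P] = 0.
Proof.
move=> P0 /(dual_EP P0)[Q [c [_ + _ [XE ZE TE]]]].
rewrite meval_E_poly meval_F_B /dual_sextic_form /weierstrass_form.
rewrite -[P 2 ^+ 2]sqrrN ZE XE TE.
move: (Q 0) (Q 1) (Q 2) => U V W.
(* At infinity the equation forces [U = 0]. Elsewhere it can be solved for [V ^+ 2], and [V] occurs
   in the goal only through its square. *)
have [->|W0] := eqVneq W 0.
  move=> h; have : U ^+ 3 = 0 by apply/eqP; rewrite -oppr_eq0; apply/eqP; rewrite -[RHS]h; ring.
  by move/eqP; rewrite expf_eq0 /= => /eqP ->; ring.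
move=> h; have VE : V ^+ 2 = (U ^+ 3 + a * U * W ^+ 2 + b * W ^+ 3) / W.
  by apply: (mulIf W0); rewrite divfK //; apply/eqP; rewrite -subr_eq0 h.
have -> : (c * (2 * V * W)) ^+ 2 = c ^+ 2 * 4 * V ^+ 2 * W ^+ 2 by ring.
by rewrite VE; field.
Qed.

(** A double root [u] would give [a = -3 u^2] and [b = 2 u^3], making [4 a^3 + 27 b^2] vanish. *)
Lemma smooth_root u : u ^+ 3 + a * u + b = 0 -> 3 * u ^+ 2 + a != 0.
Proof.
move=> hu; apply: contra smooth => /eqP hd.
have aE : a = - 3 * u ^+ 2 by apply/eqP; rewrite -subr_eq0 -hd; apply/eqP; ring.
have bE : b = 2 * u ^+ 3.
  by apply/eqP; rewrite -subr_eq0 -hu aE; apply/eqP; ring.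
by rewrite aE bE; apply/eqP; ring.
Qed.

Lemma depressed_double_root (p q : K) : 4 * p ^+ 3 + 27 * q ^+ 2 = 0 ->
  exists2 y, y ^+ 3 + p * y + q = 0 & 3 * y ^+ 2 + p = 0.
Proof.
move=> h; have [p0|p0] := eqVneq p 0.
  exists 0; last by rewrite p0; ring.
  move/eqP: h; rewrite p0 expr0n mulr0 add0r mulf_eq0 pnatr_eq0 expf_eq0 /= => /eqP ->; ring.
(* A double root [y] has [p = -3 y^2] and [q = 2 y^3], whence [y = -3q/(2p)]. *)
exists (- (3 * q / (2 * p))).
  rewrite (_ : _ + _ = - q / (8 * p ^+ 3) * (4 * p ^+ 3 + 27 * q ^+ 2)); last by field.
  by rewrite h mulr0.
rewrite (_ : _ + _ = (4 * p ^+ 3 + 27 * q ^+ 2) / (4 * p ^+ 2)); last by field.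
by rewrite h mul0r.
Qed.

Lemma F_B_sub_dual_E P : nonzero_coords P -> (F_B a b).@[P] = 0 -> dual_E a b P.
Proof.
move=> P0 FP; apply/(dual_EP P0); move: FP; rewrite meval_F_B /dual_sextic_form.
have [Z0|Z0] := eqVneq (P 2) 0; last first.
  set T := P 0; set X := P 1; set Z := P 2 in Z0 *.
  move=> FP; pose x := X / Z; pose t := T / Z.
  (* [p] and [q] are the coefficients of the cubic in [u] after [u = x^2/3 + y]; the value of the
     sextic is [- Z^6 (4 p^3 + 27 q^2)]. *)
  pose p := a - 2 * t * x - x ^+ 4 / 3.
  pose q := - (2 / 27) * x ^+ 6 + (a - 2 * t * x) * x ^+ 2 / 3 + b - t ^+ 2.
  have XE : X = x * Z by rewrite divfK.
  have TE : T = t * Z by rewrite divfK.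
  have [|y hy hy'] := @depressed_double_root p q.
    apply: (mulfI (expf_neq0 6 Z0)); rewrite mulr0 -oppr0 -[in RHS]FP XE TE /p /q.
    by field.
  pose u := x ^+ 2 / 3 + y; pose v := x * u + t.
  have hv : v ^+ 2 = u ^+ 3 + a * u + b.
    by apply/eqP; rewrite eq_sym -subr_eq0 -hy /p /q /v /u; apply/eqP; field.
  have hd : 3 * u ^+ 2 + a = 2 * x * v.
    by apply/eqP; rewrite -subr_eq0 -hy' /p /v /u; apply/eqP; field.
  (* If [v = 0], then [u] would be a double root of [u^3 + a u + b]. *)
  have v0 : v != 0.
    apply/eqP => v0; have /smooth_root/eqP[] : u ^+ 3 + a * u + b = 0.
      by rewrite -hv v0 expr0n.
    by rewrite hd v0 mulr0.
  (* The scalar is read off the middle coordinate, [- Z = c * (2 * v)]. *)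
  exists (point3 u v 1), (- Z / (2 * v)); rewrite meval_E_poly /weierstrass_form !point3E.
  split.
  - by exists 2; rewrite point3E oner_neq0.
  - by rewrite mulr1 hv; ring.
  - by rewrite mulf_neq0 ?oppr_eq0 ?invr_eq0 ?mulf_neq0 ?pnatr_eq0.
  have aE : a = 2 * x * v - 3 * u ^+ 2 by rewrite -hd; ring.
  have bE : b = v ^+ 2 - u ^+ 3 - a * u by rewrite hv; ring.
  have tE : t = v - x * u by rewrite /v; ring.
  split.
  - by rewrite XE aE; field.
  - by field.
  - by rewrite TE tE bE aE; field.
rewrite Z0 => FP; have [X0|X0] := eqVneq (P 1) 0.
  (* The line at infinity, tangent at the flex [[0, 1, 0]]. *)
  exists (point3 0 1 0), (P 0); rewrite meval_E_poly /weierstrass_form !point3E; split.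
  - by exists 1; rewrite point3E oner_neq0.
  - by ring.
  - by case: P0; apply: ord3P; rewrite ?X0 ?Z0 ?eqxx.
  by split; rewrite ?X0 ?Z0; ring.
(* A vertical line at abscissa [u]. On [Z = 0] the sextic becomes [4 X^6 (u^3 + a u + b)], so the
   contact point is [(u, 0)]. *)
pose u := - (P 0 / P 1).
have TE : P 0 = - u * P 1 by rewrite opprK divfK.
have hu : u ^+ 3 + a * u + b = 0.
  apply: (mulfI (expf_neq0 6 X0)); apply: (@mulfI _ 4); first by rewrite pnatr_eq0.
  by rewrite !mulr0 -[RHS]FP TE; ring.
have hd := smooth_root hu.
have bE : b = - u ^+ 3 - a * u by apply/eqP; rewrite -subr_eq0 -hu; apply/eqP; ring.
have hd' : - 3 * u ^+ 2 - a != 0 by rewrite mulNr -opprD oppr_eq0.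
exists (point3 u 0 1), (P 1 / (- 3 * u ^+ 2 - a)); rewrite meval_E_poly /weierstrass_form !point3E; split.
- by exists 2; rewrite point3E oner_neq0.
- by rewrite (_ : _ - _ = - (u ^+ 3 + a * u + b)); [rewrite hu oppr0 | ring].
- by rewrite mulf_neq0 ?invr_eq0.
split.
- by rewrite expr1n mulr1 divfK.
- by ring.
- by rewrite TE bE; field.
Qed.

Lemma F_B_neq0 : F_B a b != 0.
Proof.
(* At [[0, 0, 1]] the sextic takes the value [- (4 a^3 + 27 b^2)]. *)
apply: contra smooth => /eqP FB0; have := meval_F_B a b (point3 0 0 1).
rewrite FB0 meval0 /dual_sextic_form !point3E => /esym/eqP; rewrite -oppr_eq0 => /eqP h.
by apply/eqP; rewrite -[RHS]h; ring.
Qed.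

Lemma F_B_dual_curve : plane_curve_given_by (dual_E a b) (F_B a b) 6.
Proof.
split; [exact: F_B_neq0 | exact: dhomog_homogenize | move=> P P0].
by split; [exact: dual_E_sub_F_B | exact: F_B_sub_dual_E].
Qed.

End DualCurve.

(** * The torus decomposition: identity, coprimality, homogeneity *)

Section TorusDecomposition.
Variable K : numClosedFieldType.
Variables a b cbrt sqrt : K.
Hypotheses (hcbrt : cbrt ^+ 3 = -4) (hsqrt : sqrt ^+ 2 = -27).

Local Notation T := ('X_0 : {mpoly K[3]}).
Local Notation X := ('X_1 : {mpoly K[3]}).
Local Notation Z := ('X_2 : {mpoly K[3]}).

Definition torus_sextic : {mpoly K[3]} :=
  sqrt *: (- (2 / 27) *: X ^+ 6
           - 3^-1 *: ((2 *: (T * X * Z ^+ 2) - a *: Z ^+ 4) * X ^+ 2)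
           - T ^+ 2 * Z ^+ 4 + b *: Z ^+ 6).

Definition torus_quartic : {mpoly K[3]} :=
  cbrt *: (- 3^-1 *: X ^+ 4 - 2 *: (T * X * Z ^+ 2) + a *: Z ^+ 4).

Lemma torus_sexticE : torus_sextic =
  sqrt%:MP * depressed_constant_form (3^-1)%:MP a%:MP b%:MP T X Z.
Proof.
rewrite /torus_sextic (_ : 2 / 27 = 2 * (3^-1) ^+ 3); last by field.
by rewrite -!mul_mpolyC /depressed_constant_form; ring.
Qed.

Lemma torus_quarticE : torus_quartic =
  cbrt%:MP * depressed_linear_form (3^-1)%:MP a%:MP T X Z.
Proof. by rewrite /torus_quartic -!mul_mpolyC /depressed_linear_form; ring. Qed.

Lemma F_B_torus : Z ^+ 6 * F_B a b = torus_quartic ^+ 3 + torus_sextic ^+ 2.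
Proof.
have h3 : 3 * (3^-1)%:MP = 1 :> {mpoly K[3]}.
  by rewrite -mpolyC_nat -mpolyCM divff ?pnatr_eq0.
rewrite F_B_explicit (depressed_cubic_identity _ _ _ _ _ h3).
rewrite torus_quarticE torus_sexticE !exprMn -!rmorphXn /= hcbrt hsqrt.
by rewrite !rmorphN /= !mpolyC_nat.
Qed.

Lemma meval_torus_sextic (P : 'I_3 -> K) : torus_sextic.@[P] =
  sqrt * depressed_constant_form 3^-1 a b (P 0) (P 1) (P 2).
Proof.
by rewrite torus_sexticE mevalM rmorph_depressed_constant_form /= !mevalC !mevalXU.
Qed.

Lemma meval_torus_quartic (P : 'I_3 -> K) : torus_quartic.@[P] =
  cbrt * depressed_linear_form 3^-1 a (P 0) (P 1) (P 2).
Proof.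
by rewrite torus_quarticE mevalM rmorph_depressed_linear_form /= !mevalC !mevalXU.
Qed.

Lemma cbrt_neq0 : cbrt != 0.
Proof.
apply: contra_eq_neq hcbrt => ->.
by rewrite expr0n eq_sym oppr_eq0 pnatr_eq0.
Qed.

Lemma sqrt_neq0 : sqrt != 0.
Proof.
apply: contra_eq_neq hsqrt => ->.
by rewrite expr0n eq_sym oppr_eq0 pnatr_eq0.
Qed.

Lemma lead_coef_torus_sextic : lead_coef (poly_in_X torus_sextic) \is a GRing.unit.
Proof.
(* The part of degree at most 3 in [X]; the remaining term is a nonzero constant times [X^6]. *)
pose q : {poly {mpoly K[3]}} :=
  (sqrt%:MP * - (2 * (3^-1)%:MP * T * Z ^+ 2))%:P * 'X^3
  + (sqrt%:MP * (3^-1)%:MP * a%:MP * Z ^+ 4)%:P * 'X^2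
  + (sqrt%:MP * (b%:MP * Z ^+ 6 - T ^+ 2 * Z ^+ 4))%:P.
apply: (@lead_coef_poly_in_X_unit _ _ (sqrt * (- 2 * 3^-1 ^+ 3)) 6 q).
- by rewrite mulf_neq0 ?sqrt_neq0 // mulf_neq0 ?oppr_eq0 ?expf_neq0 ?invr_eq0 ?pnatr_eq0.
- rewrite /q (leq_trans (size_polyD _ _)) // geq_max.
  rewrite (leq_trans (size_polyC_leq1 _)) // andbT.
  rewrite (leq_trans (size_polyD _ _)) // geq_max !mul_polyC.
  by rewrite !(leq_trans (size_scale_leq _ _)) ?size_polyXn.
rewrite torus_sexticE rmorphM rmorph_depressed_constant_form /=.
by rewrite !poly_in_XC !poly_in_XU !point3E /depressed_constant_form /q; ring.
Qed.

Lemma lead_coef_torus_quartic : lead_coef (poly_in_X torus_quartic) \is a GRing.unit.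
Proof.
pose q : {poly {mpoly K[3]}} :=
  (cbrt%:MP * - (2 * T * Z ^+ 2))%:P * 'X + (cbrt%:MP * a%:MP * Z ^+ 4)%:P.
apply: (@lead_coef_poly_in_X_unit _ _ (cbrt * - 3^-1) 4 q).
- by rewrite mulf_neq0 ?cbrt_neq0 // oppr_eq0 ?invr_eq0 ?pnatr_eq0.
- rewrite /q (leq_trans (size_polyD _ _)) // geq_max.
  rewrite (leq_trans (size_polyC_leq1 _)) // andbT.
  by rewrite !mul_polyC !(leq_trans (size_scale_leq _ _)) ?size_polyX.
rewrite torus_quarticE rmorphM rmorph_depressed_linear_form /=.
by rewrite !poly_in_XC !poly_in_XU !point3E /depressed_linear_form /q; ring.
Qed.

Lemma coprime_torus_sextic_Z : coprime_mpoly torus_sextic Z.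
Proof.
apply: (coprime_mpoly_of_line (P := fun=> 1) lead_coef_torus_sextic) => x _.
by apply/eqP; rewrite mevalXU oner_neq0.
Qed.

Lemma coprime_torus_quartic_Z : coprime_mpoly torus_quartic Z.
Proof.
apply: (coprime_mpoly_of_line (P := fun=> 1) lead_coef_torus_quartic) => x _.
by apply/eqP; rewrite mevalXU oner_neq0.
Qed.

(* The common zeros of the two forms on Z = 1 are the eight affine cusps of the
   dual curve; the chosen line T = t contains none of them. *)
Lemma coprime_torus_forms : 4 * a ^+ 3 + 27 * b ^+ 2 != 0 ->
  coprime_mpoly torus_sextic torus_quartic.
Proof.
(* For [a = 0] the line [T = 0] suffices: both forms vanish there only if [x = 0] and [b = 0].
   Otherwise [t^2 = b] cancels the terms [b - t^2] of the sextic form. *)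
move=> smooth; pose t := if a == 0 then 0 else sqrtC b.
apply: (coprime_mpoly_of_line (P := point3 t 0 1) lead_coef_torus_sextic) => x.
rewrite meval_torus_sextic meval_torus_quartic !point3E.
move=> /eqP; rewrite mulf_eq0 (negPf sqrt_neq0) /= => /eqP q0.
move=> /eqP; rewrite mulf_eq0 (negPf cbrt_neq0) /= => /eqP p0.
have eq0_X4 : x ^+ 4 = 0 -> x = 0 by move/eqP; rewrite expf_eq0 => /eqP.
move: p0 q0; rewrite /t; have [aE|a0] := eqVneq a 0.
  rewrite aE => p0 q0; have x0 : x = 0.
    apply: eq0_X4; rewrite (_ : _ ^+ 4 = -3 * depressed_linear_form 3^-1 0 0 x 1).
      by rewrite p0 mulr0.
    by rewrite /depressed_linear_form; field.
  have b0 : b = 0.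
    by rewrite -[RHS]q0 x0 /depressed_constant_form; ring.
  by move: smooth; rewrite aE b0 !expr0n !mulr0 addr0 eqxx.
move: (sqrtC b) (sqrtCK b) => s sb p0 q0.
(* This combination of the two forms eliminates [x^6]. Either factor then leads to [x = 0], and so
   to [a = 0]. *)
have : x ^+ 2 * (a - 2 * s * x) = 0.
  rewrite (_ : _ * _ = 9 * depressed_constant_form 3^-1 a b s x 1
                       - 2 * x ^+ 2 * depressed_linear_form 3^-1 a s x 1).
    by rewrite p0 q0 !mulr0 subr0.
  by rewrite -sb /depressed_linear_form /depressed_constant_form; field.
move/eqP; rewrite mulf_eq0 expf_eq0 /= => /orP[/eqP x0|/eqP ax].
  by move/eqP: a0; apply; rewrite -[RHS]p0 x0 /depressed_linear_form; ring.
have x0 : x = 0.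
  apply: eq0_X4; rewrite (_ : _ ^+ 4 = -3 * depressed_linear_form 3^-1 a s x 1
                                       + 3 * (a - 2 * s * x)).
    by rewrite p0 ax !mulr0 addr0.
  by rewrite /depressed_linear_form; field.
by move/eqP: a0; apply; rewrite -[RHS]ax x0; ring.
Qed.

Lemma homog_mpolyXn (i : 'I_3) n : ('X_i : {mpoly K[3]}) ^+ n \is n.-homog.
Proof. by rewrite mpolyXn dhomogX /= mdegMn mdeg1 mul1n. Qed.

Lemma homog_TXZ2 : T * X * Z ^+ 2 \is 4.-homog.
Proof.
apply: (@dhomogM _ _ _ 2 _ 2); last exact: homog_mpolyXn.
by apply: (@dhomogM _ _ _ 1 _ 1); rewrite dhomogX /= mdeg1.
Qed.

Lemma homog_torus_quartic : torus_quartic \is 4.-homog.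
Proof.
by apply/rpredZ/rpredD; [apply: rpredB|]; apply: rpredZ;
  rewrite ?homog_mpolyXn ?homog_TXZ2.
Qed.

Lemma homog_torus_sextic : torus_sextic \is 6.-homog.
Proof.
apply/rpredZ/rpredD; last exact/rpredZ/homog_mpolyXn.
apply: rpredB; last by apply: (@dhomogM _ _ _ 2 _ 4); exact: homog_mpolyXn.
apply: rpredB; first exact/rpredZ/homog_mpolyXn.
apply/rpredZ/(@dhomogM _ _ _ 4 _ 2); last exact: homog_mpolyXn.
by apply: rpredB; apply: rpredZ; rewrite ?homog_mpolyXn ?homog_TXZ2.
Qed.

Lemma quasi_torus_F_B : 4 * a ^+ 3 + 27 * b ^+ 2 != 0 ->
  quasi_torus_decomposition 2 3 6 (F_B a b) torus_sextic torus_quartic Z.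
Proof.
move=> smooth; split; first split.
- by exists 6; exact: homog_torus_sextic.
- by exists 4; exact: homog_torus_quartic.
- by exists 1; rewrite dhomogX /= mdeg1.
split; last by rewrite F_B_torus addrC.
split; first exact: coprime_torus_forms.
- exact: coprime_torus_sextic_Z.
- exact: coprime_torus_quartic_Z.
Qed.

End TorusDecomposition.

Theorem mainTheorem2 (R : realType) (a b : R[i])
    (hab : 4 * a ^+ 3 + 27 * b ^+ 2 != 0)
    (cbrt sqrt : R[i]) (hcbrt : cbrt ^+ 3 = -4) (hsqrt : sqrt ^+ 2 = -27) :
  let T : {mpoly R[i][3]} := 'X_0 in
  let X : {mpoly R[i][3]} := 'X_1 in
  let Z : {mpoly R[i][3]} := 'X_2 in
  let F1 := sqrt *: (- (2 / 27) *: X ^+ 6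
                     - 3^-1 *: ((2 *: (T * X * Z ^+ 2) - a *: Z ^+ 4) * X ^+ 2)
                     - T ^+ 2 * Z ^+ 4 + b *: Z ^+ 6) in
  let F2 := cbrt *: (- 3^-1 *: X ^+ 4 - 2 *: (T * X * Z ^+ 2) + a *: Z ^+ 4) in
  [/\ plane_curve_given_by (dual_E a b) (F_B a b) 6,
      Z ^+ 6 * F_B a b = F2 ^+ 3 + F1 ^+ 2
    & quasi_torus_decomposition 2 3 6 (F_B a b) F1 F2 Z].
Proof.
split; first exact: F_B_dual_curve.
  exact: F_B_torus.
exact: quasi_torus_F_B.
Qed.
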